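(* Let $a,c\in\mathbb{C}$ and suppose that $M=\mathbb{C}[\partial]v$ is a nontrivial $\mathcal{CW}(a,c)$-module of rank one. Then $a=0$, and the $\lambda$-actions on $M$ are given as follows: (1) if $c=0$, there exist $h_i(\lambda)\in\mathbb{C}[\lambda]$ ($i\in\mathbb{Z}$) such that $L_i\,{}_\lambda\,v=h_i(\lambda)v$ for all $i\in\mathbb{Z}$; (2) if $c\neq0$, there exist $\rho,\sigma\in\mathbb{C}$ and $\tau\in\mathbb{C}\setminus\{0\}$ such that $L_i\,{}_\lambda\,v=\tau^i(c\partial+\rho\lambda+\sigma)v$ for all $i\in\mathbb{Z}$.
   Context: A Lie conformal algebra is a $\mathbb{C}[\partial]$-module $R$ with a linear map $R\otimes R\to R[\lambda]$, $x\otimes y\mapsto[x\,{}_\lambda\,y]$, such that for all $x,y,z\in R$: $[\partial x\,{}_\lambda\,y]=-\lambda[x\,{}_\lambda\,y]$, $[x\,{}_\lambda\,\partial y]=(\partial+\lambda)[x\,{}_\lambda\,y]$, $[x\,{}_\lambda\,y]=-[y\,{}_{-\lambda-\partial}\,x]$, and $[x\,{}_\lambda\,[y\,{}_\mu\,z]]=[[x\,{}_\lambda\,y]\,{}_{\lambda+\mu}\,z]+[y\,{}_\mu\,[x\,{}_\lambda\,z]]$. For $a,c\in\mathbb{C}$, $\mathcal{CW}(a,c)$ is the Lie conformal algebra that is free as a $\mathbb{C}[\partial]$-module with basis $\{L_i\mid i\in\mathbb{Z}\}$ and has $\lambda$-brackets $[L_i\,{}_\lambda\,L_j]=\big((ai+c)\partial+(a(i+j)+2c)\lambda\big)L_{i+j}$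 for $i,j\in\mathbb{Z}$. A (conformal) module over a Lie conformal algebra $R$ is a $\mathbb{C}[\partial]$-module $V$ with a $\lambda$-action, i.e. a linear map $R\otimes V\to V[\lambda]$, $x\otimes v\mapsto x\,{}_\lambda\,v$, such that for all $x,y\in R$, $v\in V$: $(\partial x)\,{}_\lambda\,v=-\lambda\,x\,{}_\lambda\,v$, $x\,{}_\lambda\,(\partial v)=(\partial+\lambda)\,x\,{}_\lambda\,v$, and $x\,{}_\lambda\,(y\,{}_\mu\,v)-y\,{}_\mu\,(x\,{}_\lambda\,v)=[x\,{}_\lambda\,y]\,{}_{\lambda+\mu}\,v$. It is of rank $n$ if $V$ is a free $\mathbb{C}[\partial]$-module of rank $n$; thus a rank one module is $\mathbb{C}[\partial]v$, free on $v$. A module is trivial if its $\lambda$-action is identically zero, and nontrivial otherwise. *)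

(* Defs.v *)
From mathcomp Require Import all_boot all_order all_algebra.
From mathcomp Require Import finmap monalg.
From mathcomp Require Import complex reals.
Set Implicit Arguments.
Unset Strict Implicit.
Unset Printing Implicit Defensive.
Import GRing.Theory.
Local Open Scope ring_scope.

(* V[lambda]: finitely supported families, p@_n being the coefficient in V    *)
(* of lambda^n.                                                               *)
Notation lpoly V := {malg V[nat]}.

(* V[lambda, mu], as V[lambda][mu].                                           *)
Notation lpoly2 V := {malg {malg V[nat]}[nat]}.

Section LambdaPolynomials.

(* leval T j p is the sum over n of T^n (j p_n): the coefficients of p are    *)
(* carried into W by j, and the indeterminate is replaced by the operator T.  *)
Definition leval (V W : zmodType) (T : W -> W) (j : V -> W) (p : lpoly V) : W :=
  \sum_(n <- msupp p) iter n T (j p@_n).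

Definition lconst (V : zmodType) (v : V) : lpoly V := << v *g 0%N >>.

(* Multiplication by the indeterminate: lambda on V[lambda], mu on V[lambda][mu]. *)
Definition lamX (V : zmodType) (p : lpoly V) : lpoly V :=
  \sum_(n <- msupp p) << p@_n *g n.+1 >>.

Definition lmap (V W : zmodType) (f : V -> W) (p : lpoly V) : lpoly W :=
  \sum_(n <- msupp p) << f p@_n *g n >>.

Definition lam2 (V : zmodType) (w : lpoly2 V) : lpoly2 V := lmap (@lamX V) w.
Definition mu2 (V : zmodType) (w : lpoly2 V) : lpoly2 V := lamX w.

(* at2 T p is p(T) in V[lambda, mu], e.g. for T = lambda, mu, lambda + mu.    *)
Definition at2 (V : zmodType) (T : lpoly2 V -> lpoly2 V) (p : lpoly V) :
  lpoly2 V := leval T (fun v => lconst (lconst v)) p.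

End LambdaPolynomials.

Section Conformal.
Variable K : fieldType.

(* A K[d]-module is an lmodType over {poly K}, the variable 'X being d.       *)
Definition dd (V : lmodType {poly K}) (v : V) : V := 'X *: v.

Definition ldd (V : lmodType {poly K}) (p : lpoly V) : lpoly V :=
  lmap (@dd V) p.

Definition lscale (V : lmodType {poly K}) (k : K) (p : lpoly V) : lpoly V :=
  lmap (fun v => k%:P *: v) p.

(* act x v stands for x _lambda v; the first two items say that act is a      *)
(* K-linear map on the tensor product of U and V over K.                      *)
Definition sesquilinear (U V : lmodType {poly K}) (act : U -> V -> lpoly V) :
    Prop :=
  [/\ forall k x x' v,
        act (k%:P *: x + x') v = lscale k (act x v) + act x' v,
      forall k x v v',
        act x (k%:P *: v + v') = lscale k (act x v) + act x v',
      forall x v, act (dd x) v = - lamX (act x v)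
    & forall x v, act x (dd v) = ldd (act x v) + lamX (act x v)].

(* [x _lambda y] = - [y _(- lambda - d) x], where the d coming from the       *)
(* substitution acts on the coefficients of [y _lambda x].                    *)
Definition conf_skew (U : lmodType {poly K}) (br : U -> U -> lpoly U) : Prop :=
  forall x y,
    br x y = - leval (fun p => - lamX p - ldd p) (@lconst U) (br y x).

(* x _lambda (y _mu v) - y _mu (x _lambda v) = [x _lambda y] _(lambda + mu) v *)
(* in V[lambda, mu].                                                          *)
Definition conf_action (U V : lmodType {poly K}) (br : U -> U -> lpoly U)
    (act : U -> V -> lpoly V) : Prop :=
  forall x y v,
      leval (@mu2 V) (fun u => at2 (@lam2 V) (act x u)) (act y v)
    - leval (@lam2 V) (fun u => at2 (@mu2 V) (act y u)) (act x v)
    = leval (@lam2 V) (fun u => at2 (@lam2 V \+ @mu2 V) (act u v)) (br x y).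

(* [x _lambda [y _mu z]] = [[x _lambda y] _(lambda + mu) z]                   *)
(*                         + [y _mu [x _lambda z]]                            *)
Definition conf_jacobi (U : lmodType {poly K}) (br : U -> U -> lpoly U) :
    Prop :=
  forall x y z,
      leval (@mu2 U) (fun u => at2 (@lam2 U) (br x u)) (br y z)
    = leval (@lam2 U) (fun u => at2 (@lam2 U \+ @mu2 U) (br u z)) (br x y)
    + leval (@lam2 U) (fun u => at2 (@mu2 U) (br y u)) (br x z).

Record lieConfAlg := LieConfAlg {
  lca_sort :> lmodType {poly K};
  bracket : lca_sort -> lca_sort -> lpoly lca_sort;
  bracket_sesqui : sesquilinear bracket;
  bracket_skew : conf_skew bracket;
  bracket_jacobi : conf_jacobi bracket
}.

Record confModule (A : lieConfAlg) := ConfModule {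
  cm_sort :> lmodType {poly K};
  laction : A -> cm_sort -> lpoly cm_sort;
  laction_sesqui : sesquilinear laction;
  laction_bracket : conf_action (@bracket A) laction
}.

Definition nontrivial_module (A : lieConfAlg) (M : confModule A) : Prop :=
  ~ (forall (x : A) (m : M), laction x m = 0).

Definition is_basis (I : choiceType) (V : lmodType {poly K}) (e : I -> V) :
    Prop :=
  forall x : V, exists! q : {malg {poly K}[I]},
    x = \sum_(i <- msupp q) q@_i *: e i.

Definition free_on (V : lmodType {poly K}) (v : V) : Prop :=
  is_basis (fun _ : unit => v).

(* Elements of K[d][lambda]; lact f v is f(d, lambda) v in V[lambda].         *)
Definition dvar : {poly {poly K}} := 'X%:P.
Definition lvar : {poly {poly K}} := 'X.
Definition scal (k : K) : {poly {poly K}} := k%:P%:P.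

Definition lact (V : lmodType {poly K}) (f : {poly {poly K}}) (v : V) :
  lpoly V := \sum_(n < size f) << f`_n *: v *g (n : nat) >>.

Definition is_CW (a c : K) (A : lieConfAlg) (L : int -> A) : Prop :=
  is_basis L /\
  forall i j : int,
    bracket (L i) (L j) =
      lact (scal (a *~ i + c) * dvar + scal (a *~ (i + j) + c *+ 2) * lvar)
           (L (i + j)).

End Conformal.

(* Main.v *)
Require Import Defs.
From HB Require Import structures.
From mathcomp Require Import all_boot all_order all_algebra.
From mathcomp Require Import finmap monalg.
From mathcomp Require Import boolp complex reals.
From mathcomp Require Import ring zify.
(** Write [L_i _lambda v = f_i(d, lambda) v].  Expanding the module identity
    for [L_i], [L_j] and [v], and comparing coefficients of the free generator,
    turns the theorem into one functional equation between polynomials: with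
    [w_i = a i + c],

      f_j(d + l, u) f_i(d, l) - f_i(d + u, l) f_j(d, u)
        = (w_j l - w_i u) f_(i+j)(d, l + u)

    ([symbol_relation]).  The variables [lambda] and [mu] are replaced
    throughout by scalars [l] and [u]: the base field is infinite, so nothing is
    lost, and the whole argument takes place in polynomials in [d] whose
    coefficients are polynomials in [lambda].

    The equation is analysed through degrees in [d].  If [f_i] and [f_j] have
    degrees [m], [n] and leading coefficients [A_i], [A_j], the terms of degree
    [m + n] on the left cancel, and the coefficient of [d^(m+n-1)] is
    [(n l - m u) A_i(l) A_j(u)] ([coef_shift_commutator]).

    Suppose that no [f_i] involves [d].  Then the left-hand side vanishes, so
    [w_j <> 0] for some [j] would make every [f_k = f_((k-j)+j)] zero; as the
    module is nontrivial, [a = c = 0], which is case (1).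

    Suppose that some [f_i] has positive degree.  The pair [(i, i)] gives
    [w_i <> 0]; the pair [(0, i)] then shows that [f_0] has positive degree, and
    the pair [(0, 0)] that this degree is [1], that [c <> 0] and that
    [A_0 = c].  Now the pair [(k, 0)] forces each nonzero [f_k] to have a constant
    leading coefficient and degree [d_k] with [c d_k = a k + c]
    ([symbol_lead_const]), and the pair [(k, -k)] forces [f_k <> 0]
    ([symbol_neq0]).  So [1 + (a/c) k] is a natural number for all integers
    [k], whence [a = 0] and all degrees are [1].  The leading coefficients
    satisfy [A_i A_j = c A_(i+j)], so [A_i = c tau^i]; the constant terms are
    [tau^i b(lambda)] for one polynomial [b] with
    [l b(l) - u b(u) = (l - u) b(l + u)], which forces [b] to be affine
    ([size_le2_of_functional]).  This is case (2). *)

Set Implicit Arguments.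
Unset Strict Implicit.
Unset Printing Implicit Defensive.
Import GRing.Theory Num.Theory.
Local Open Scope ring_scope.

(** * Evaluating lambda-polynomials at scalars *)

Section Evaluation.
Variables (K : fieldType) (V : lmodType {poly K}).

(** The value at [l] of [j p], where [j] acts on the coefficients.  Taking for
    [j] an evaluation again, [lev (lev idfun l) u] evaluates an element of
    [V[lambda][mu]] at [lambda = l], [mu = u]. *)
Definition lev (U : zmodType) (j : U -> V) (l : K) (p : lpoly U) : V :=
  \sum_(n <- msupp p) (l ^+ n)%:P *: j p@_n.

Section Additivity.
Variables (U : zmodType) (j : {additive U -> V}) (l : K).

Lemma lev_wide (s : {fset nat}) (p : lpoly U) :
  (msupp p `<=` s)%fset ->
  lev j l p = \sum_(n <- s) (l ^+ n)%:P *: j p@_n.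
Proof.
move=> sub; apply: big_fset_incl => // n _ /mcoeff_outdom ->.
by rewrite raddf0 scaler0.
Qed.

Lemma lev_is_zmod_morphism : zmod_morphism (lev j l).
Proof.
move=> p q; set s := (msupp p `|` msupp q)%fset.
rewrite (@lev_wide s) ?msuppB_le // !(@lev_wide s) ?fsubsetUl ?fsubsetUr //.
by rewrite -sumrB; apply: eq_bigr => n _; rewrite mcoeffB raddfB scalerBr.
Qed.

HB.instance Definition _ :=
  GRing.isZmodMorphism.Build (lpoly U) V (lev j l) lev_is_zmod_morphism.

Lemma lev_monom u n : lev j l << u *g n >> = (l ^+ n)%:P *: j u.
Proof. by rewrite (lev_wide msuppU_le) big_seq_fset1 mcoeffUU. Qed.

Lemma lev_lconst u : lev j l (lconst u) = j u.
Proof. by rewrite lev_monom scale1r. Qed.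

Lemma lev_lamX p : lev j l (lamX p) = l%:P *: lev j l p.
Proof.
rewrite raddf_sum scaler_sumr; apply: eq_bigr => n _ /=.
by rewrite lev_monom exprS polyCM -scalerA.
Qed.

Lemma lev_lmap (f : U -> U) q :
  (forall u, j (f u) = q *: j u) ->
  forall p, lev j l (lmap f p) = q *: lev j l p.
Proof.
move=> jf p; rewrite raddf_sum scaler_sumr; apply: eq_bigr => n _ /=.
by rewrite lev_monom jf !scalerA mulrC.
Qed.

(** Substituting an operator for the indeterminate becomes, after evaluation,
    substituting the scalar by which that operator acts. *)
Lemma lev_leval (T : lpoly U -> lpoly U) (W : zmodType) (g : W -> lpoly U)
    (t : K) :
  (forall p, lev j l (T p) = t%:P *: lev j l p) ->
  forall p, lev j l (leval T g p) = lev (lev j l \o g) t p.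
Proof.
move=> jT p; rewrite raddf_sum; apply: eq_bigr => n _ /=.
elim: n (g _) => [|n IHn] w; first by rewrite scale1r.
by rewrite iterS jT IHn scalerA -polyCM exprS.
Qed.

End Additivity.

Lemma lev_lact f (v : V) l : lev idfun l (lact f v) = f.[l%:P] *: v.
Proof.
rewrite raddf_sum horner_coef scaler_suml; apply: eq_bigr => n _ /=.
by rewrite lev_monom /= scalerA mulrC polyC_exp.
Qed.

Lemma eq_lev (U : zmodType) (j j' : U -> V) l p :
  j =1 j' -> lev j l p = lev j' l p.
Proof. by move=> jj'; apply: eq_bigr => n _; rewrite jj'. Qed.

End Evaluation.

(** * The lambda-action at a scalar *)

Section EvaluatedAction.
Variables (K : fieldType) (U V : lmodType {poly K}) (act : U -> V -> lpoly V).
Hypothesis actP : sesquilinear act.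

Definition eact (l : K) (x : U) (v : V) : V := lev idfun l (act x v).

Lemma eact_linearl l k x x' v :
  eact l (k%:P *: x + x') v = k%:P *: eact l x v + eact l x' v.
Proof.
rewrite /eact; case: actP => + _ _ _ => ->; rewrite raddfD /=.
by congr (_ + _); apply: lev_lmap.
Qed.

Lemma eact_linearr l k x v v' :
  eact l x (k%:P *: v + v') = k%:P *: eact l x v + eact l x v'.
Proof.
rewrite /eact; case: actP => _ + _ _ => ->; rewrite raddfD /=.
by congr (_ + _); apply: lev_lmap.
Qed.

Lemma eactDl l v : {morph eact l ^~ v : x y / x + y}.
Proof.
by move=> x y; rewrite -[x]scale1r -polyC1 eact_linearl polyC1 !scale1r.
Qed.

Lemma eactDr l x : {morph eact l x : v w / v + w}.
Proof.
by move=> v w; rewrite -[v]scale1r -polyC1 eact_linearr polyC1 !scale1r.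
Qed.

Lemma eact0l l v : eact l 0 v = 0.
Proof. by apply: (addrI (eact l 0 v)); rewrite -eactDl !addr0. Qed.

Lemma eact0r l x : eact l x 0 = 0.
Proof. by apply: (addrI (eact l x 0)); rewrite -eactDr !addr0. Qed.

(** On the algebra side [d] acts as [- lambda], so a polynomial in [d] comes out
    as a scalar. *)
Lemma eactZl l q x v : eact l (q *: x) v = (q.[- l])%:P *: eact l x v.
Proof.
elim/poly_ind: q x => [|q k IHq] x;
  first by rewrite !scale0r horner0 eact0l scale0r.
rewrite scalerDl addrC eact_linearl -scalerA IHq.
case: actP => _ _ + _ => /(_ x v) act_dd.
rewrite {2}/eact act_dd raddfN /= lev_lamX -/(eact l x v).
rewrite scalerN scalerA -scaleNr -scalerDl -polyCM -polyCN -polyCD !hornerE.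
by congr (_%:P *: _); ring.
Qed.

(** On the module side moving the action past [d] shifts it to [d + lambda]. *)
Lemma eactZr l q x v :
  eact l x (q *: v) = (q \Po ('X + l%:P)) *: eact l x v.
Proof.
elim/poly_ind: q v => [|q k IHq] v.
  by rewrite comp_poly0 !scale0r eact0r.
rewrite scalerDl addrC eact_linearr -scalerA IHq.
case: actP => _ _ _ /(_ x v) act_dd.
rewrite {2}/eact act_dd raddfD /= lev_lamX (lev_lmap _ (q := 'X)) //=.
rewrite -/(eact l x v).
rewrite -scalerDl scalerA -scalerDl addrC.
by rewrite comp_polyD comp_polyM comp_polyX comp_polyC.
Qed.

Lemma lev_eactr (W : zmodType) (j : W -> V) l t x p :
  lev (eact l x \o j) t p = eact l x (lev j t p).
Proof.
rewrite /lev (big_morph _ (eactDr l x) (eact0r l x)); apply: eq_bigr => n _ /=.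
by rewrite eactZr comp_polyC.
Qed.

Lemma lev_eactl (W : zmodType) (j : W -> U) l t v p :
  lev (eact l ^~ v \o j) t p = eact l (lev j t p) v.
Proof.
rewrite /lev (big_morph _ (eactDl l v) (eact0l l v)); apply: eq_bigr => n _ /=.
by rewrite eactZl hornerC.
Qed.

(** In evaluated form the module axiom says that the operators [eact l x] and
    [eact m y] have commutator [eact (l + m) [x _l y]]. *)
Lemma eact_bracket (br : U -> U -> lpoly U) :
  conf_action br act -> forall x y v l m,
  eact l x (eact m y v) - eact m y (eact l x v)
  = eact (l + m) (lev idfun l (br x y)) v.
Proof.
move=> brP x y v l m.
pose ev2 : {additive lpoly2 V -> V} := lev (lev idfun l) m.
have ev_lam w : ev2 (lam2 w) = l%:P *: ev2 w.
  by apply: lev_lmap => u; apply: lev_lamX.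
have ev_mu w : ev2 (mu2 w) = m%:P *: ev2 w by apply: lev_lamX.
have ev_at T t p : (forall w, ev2 (T w) = t%:P *: ev2 w) ->
    ev2 (at2 T p) = lev idfun t p.
  move=> evT; rewrite /ev2 /= (lev_leval _ evT).
  by apply: eq_lev => u /=; rewrite lev_lconst /= lev_lconst.
have := congr1 ev2 (brP x y v); rewrite raddfB /=.
rewrite (lev_leval _ ev_mu) !(lev_leval _ ev_lam).
have -> : lev (lev (lev idfun l) m \o (fun u => at2 (@lam2 V) (act x u))) m
    (act y v) = eact l x (eact m y v).
  rewrite -lev_eactr; apply: eq_lev => u /=; exact: (ev_at _ _ _ ev_lam).
have -> : lev (lev (lev idfun l) m \o (fun u => at2 (@mu2 V) (act y u))) l
    (act x v) = eact m y (eact l x v).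
  rewrite -lev_eactr; apply: eq_lev => u /=; exact: (ev_at _ _ _ ev_mu).
move=> ->; rewrite -lev_eactl; apply: eq_lev => u /=; apply: ev_at => w.
rewrite raddfD /= polyCD scalerDl.
by congr (_ + _); [apply: ev_lam | apply: ev_mu].
Qed.

End EvaluatedAction.

(** * Shifts of polynomials and functional equations *)

Section PolynomialTools.
Variable K : numFieldType.

(** In characteristic zero the natural numbers are infinitely many distinct
    points, too many to be roots. *)
Lemma poly_eq0_nat (R : idomainType) (p : {poly R}) :
  [pchar R] =i pred0 -> (forall n, p.[n%:R] = 0) -> p = 0.
Proof.
move=> /pcharf0P R0 p0; apply/eqP/negPn/negP => pn0.
have inj : injective (fun n : nat => n%:R : R).
  move=> m n; wlog le_mn : m n / (m <= n)%N => [wl|] mn.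
    by have [/wl->//|/ltnW/wl->] := leqP m n.
  apply/eqP; rewrite eqn_leq le_mn -subn_eq0 -R0 natrB //.
  by rewrite mn subrr eqxx.
have := max_poly_roots pn0 (rs := [seq n%:R | n <- iota 0 (size p)]).
rewrite map_inj_uniq // iota_uniq size_map size_iota ltnn => H.
suff: false by []. apply: H => //.
by apply/allP => _ /mapP [n _ ->]; apply/rootP.
Qed.

(** The form in which vanishing is obtained below: putting one of two scalars
    equal to [0], or to the opposite of the other, in a functional equation
    leaves the other as a factor. *)
Lemma poly_eq0_mulx (p : {poly K}) : (forall x, x * p.[x] = 0) -> p = 0.
Proof.
move=> p0; have /eqP : p * 'X = 0.
  by apply: poly_eq0_nat => [|n]; [exact: pchar_num | rewrite !hornerE mulrC].
by rewrite mulf_eq0 polyX_eq0 orbF => /eqP.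
Qed.

Lemma size_shift_taylor2 (p : {poly K}) (l : K) n :
  (size p <= n.+1)%N ->
  (size (p \Po ('X + l%:P) - p - l *: p^`())%R <= n.-1)%N.
Proof.
move=> sp.
have -> : p \Po ('X + l%:P) = \sum_(i < n.+2) l ^+ i *: p^`N(i).
  rewrite /comp_poly (@nderiv_taylor_wide _ n.+2); last 2 first.
  - exact: mulrC.
  - by rewrite size_map_polyC ltnW.
  apply: eq_bigr => i _.
  by rewrite nderivn_map -/(_ \Po 'X) comp_polyXr -mul_polyC mulrC polyC_exp.
rewrite !big_ord_recl nderivn0 /= nderivn1 expr0 scale1r expr1.
set q := \sum_(i < n) _.
rewrite /= ?addrA; have -> : p + l *: p^`() + q - p - l *: p^`() = q.
  by rewrite -!mul_polyC; ring.
apply: (leq_trans (size_sum _ _ _)); apply/bigmax_leqP => i _.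
apply: (leq_trans (size_scale_leq _ _)); apply/leq_sizeP => k lek.
rewrite coef_nderivn nth_default ?mul0rn // (leq_trans sp) //.
by have := ltn_ord i; rewrite /= /bump /=; lia.
Qed.

Lemma coefM_top (R : nzSemiRingType) (f g : {poly R}) a b k :
    (size f <= a.+1)%N -> (size g <= b.+1)%N -> (a + b <= k)%N ->
  (f * g)`_k = f`_a * g`_b *+ (k == a + b)%N.
Proof.
move=> sf sg abk; have ak : (a < k.+1)%N by lia.
rewrite coefM (bigD1 (Ordinal ak)) //= big1 ?addr0 => [|i].
  case: eqP => [->|ne]; first by rewrite addKn.
  by rewrite (@nth_default _ 0 g) ?mulr0 //; apply: leq_trans sg _; lia.
rewrite -val_eqE /= => ia; have := ltn_ord i.
case: (ltnP a i) => ai ik.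
  by rewrite nth_default ?mul0r // (leq_trans sf).
by rewrite [X in _ * X]nth_default ?mulr0 // (leq_trans sg) //; lia.
Qed.

(** By Taylor, [q(X + l) p - p(X + u) q = l q' p - u p' q + ...], where the
    terms omitted have degree at most [m + n - 2]. *)
Lemma coef_shift_commutator (p q : {poly K}) (l u : K) m n k :
    (size p <= m.+1)%N -> (size q <= n.+1)%N -> (m + n <= k.+1)%N ->
  ((q \Po ('X + l%:P)) * p - (p \Po ('X + u%:P)) * q)`_k =
    (l *+ n - u *+ m) * (p`_m * q`_n) *+ (k.+1 == m + n)%N.
Proof.
move=> sp sq mnk.
set r := q \Po ('X + l%:P) - q - l *: q^`().
set s := p \Po ('X + u%:P) - p - u *: p^`().
have -> : (q \Po ('X + l%:P)) * p - (p \Po ('X + u%:P)) * q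
  = l *: (q^`() * p) - u *: (p^`() * q) + (r * p - s * q).
  by rewrite /r /s -!mul_polyC; ring.
have top (f g : {poly K}) a b :
    (size f <= a.+1)%N -> (size g <= b.+1)%N -> (a + b <= k.+1)%N ->
  (f^`() * g)`_k = f`_a *+ a * g`_b *+ (k.+1 == a + b)%N.
  case: a => [|a] sf sg abk.
    by rewrite (size1_polyC sf) derivC mul0r coef0 mul0r mul0rn.
  have sf' : (size f^`() <= a.+1)%N.
    apply/leq_sizeP => i ai.
    by rewrite coef_deriv nth_default ?mul0rn // (leq_trans sf).
  by rewrite (coefM_top sf' sg) ?coef_deriv ?addSn ?eqSS //.
have low (f g : {poly K}) a b :
    (size f <= a.-1)%N -> (size g <= b.+1)%N -> (a + b <= k.+1)%N ->
  (f * g)`_k = 0.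
  move=> sf sg abk; have [-> | f0] := eqVneq f 0; first by rewrite mul0r coef0.
  rewrite nth_default //; apply: leq_trans (size_polyMleq _ _) _.
  by move: f0; rewrite -size_poly_gt0; lia.
have nmk : (n + m <= k.+1)%N by rewrite addnC.
rewrite coefD !coefB !coefZ (top _ _ _ _ sq sp) // (top _ _ _ _ sp sq) //.
rewrite (low r p n m) ?(low s q m n) ?size_shift_taylor2 //.
rewrite [(n+m)%N]addnC; case: eqP => _; rewrite ?mulr0n ?mulr1n; last by ring.
by rewrite -[p`_m *+ m]mulr_natr -[q`_n *+ n]mulr_natr; ring.
Qed.

Lemma exists_nonroot (p : {poly K}) : p != 0 -> exists x, p.[x] != 0.
Proof.
move=> pn0; have [//|no] := pselect (exists x, p.[x] != 0).
case/eqP: pn0; apply: poly_eq0_nat => [|n]; first exact: pchar_num.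
by apply/eqP/negPn/negP => ?; case: no; exists n%:R.
Qed.

(** A symbol [f(d, lambda)] is stored as a polynomial in [d] over polynomials in
    [lambda], since degrees and leading coefficients in [d] are what the
    classification compares; [lact] uses the opposite nesting. *)
Definition evalY (l : K) (g : {poly {poly K}}) : {poly K} :=
  map_poly (horner_eval l) g.

Lemma int_exp_morph (t : int -> K) :
  t 0 = 1 -> (forall i j, t (i + j) = t i * t j) -> forall i, t i = t 1 ^ i.
Proof.
move=> t0 tD.
have tn (n : nat) : t n = t 1 ^+ n.
  by elim: n => [|n IHn]; rewrite ?expr0 // exprS -IHn -tD -PoszD add1n.
case=> n; first exact: tn.
have nz : t n.+1 != 0.
  apply/eqP => tn0; have := tD n.+1 (- n.+1%:Z).
  by rewrite subrr t0 tn0 mul0r => /eqP; rewrite oner_eq0.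
rewrite NegzE -exprnN -tn; apply: (mulfI nz).
by rewrite divff // -tD subrr.
Qed.

(** Put [u = 1]: then [l (b(l + 1) - b(l)) = b(l + 1) - b(1)].  If [b] has
    degree [n >= 2], comparing the coefficients of [l^n] gives [n b_n = b_n]. *)
Lemma size_le2_of_functional (b : {poly K}) :
    (forall l u, l * b.[l] - u * b.[u] = (l - u) * b.[l + u]) ->
  (size b <= 2)%N.
Proof.
move=> bE; rewrite leqNgt; apply/negP => sb.
pose n := (size b).-1; have sn : (size b <= n.+1)%N by rewrite /n; lia.
have n2 : (1 < n)%N by rewrite /n; lia.
pose r := b \Po ('X + 1%:P) - b - 1 *: b^`().
have sr : (size r <= n.-1)%N := size_shift_taylor2 1 sn.
have shE : b \Po ('X + 1%:P) = b + b^`() + r by rewrite /r scale1r; ring.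
clearbody r.
have : 'X * (b^`() + r) - (b + b^`() + r - b.[1]%:P) = 0.
  apply: poly_eq0_mulx => l; rewrite -shE.
  have -> : b^`() + r = b \Po ('X + 1%:P) - b by rewrite shE; ring.
  rewrite !hornerE horner_comp !hornerE.
  transitivity (l * (l * b.[l + 1] - b.[l + 1] - (l * b.[l] - 1 * b.[1]))).
    by ring.
  by rewrite bE; ring.
move=> /(congr1 (fun p : {poly K} => p`_n)).
rewrite coef0 !coefB coefXM !coefD coefC.
have -> : (n == 0)%N = false by lia.
rewrite /=.
have rk k : (n.-1 <= k)%N -> r`_k = 0.
  by move=> lek; rewrite nth_default // (leq_trans sr).
rewrite !rk ?leq_pred // !coef_deriv prednK; last by lia.
rewrite (@nth_default _ 0 b n.+1) // mul0rn !addr0 subr0.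
rewrite -[X in _ - X]mulr1n -mulrnBr; last by lia.
move=> /eqP; rewrite mulrn_eq0 subn_eq0 leqNgt n2 /=.
rewrite -lead_coefE lead_coef_eq0.
by rewrite -size_poly_eq0; case: (size _) sb.
Qed.

(** * Solving the functional equation of the symbols *)

Section SymbolRelation.
Variables (a c : K) (G : int -> {poly {poly K}}).
Let w (i : int) : K := a *~ i + c.
Hypothesis G_rel : forall i j l u,
    (evalY u (G j) \Po ('X + l%:P)) * evalY l (G i)
    - (evalY l (G i) \Po ('X + u%:P)) * evalY u (G j)
  = (w j * l - w i * u) *: evalY (l + u) (G (i + j)).

(** The functional equation at [d^k], with [m] and [n] only bounds for the
    degrees, so that symbols that may be zero are covered. *)
Lemma symbol_coef_relation i j m n k l u :
    (size (G i) <= m.+1)%N -> (size (G j) <= n.+1)%N -> (m + n <= k.+1)%N ->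
  (w j * l - w i * u) * ((G (i + j))`_k).[l + u]
  = (l *+ n - u *+ m) * (((G i)`_m).[l] * ((G j)`_n).[u]) *+ (k.+1 == m + n)%N.
Proof.
move=> si sj mnk; have /(congr1 (fun p : {poly K} => p`_k)) := G_rel i j l u.
rewrite coefZ coef_map /= /horner_eval => <-.
rewrite (coef_shift_commutator _ _ (m := m) (n := n) (k := k)) //; last 2 first.
- exact: leq_trans (size_poly _ _) si.
- exact: leq_trans (size_poly _ _) sj.
by rewrite !coef_map.
Qed.

(** The left-hand side of the functional equation vanishes; write
    [k = (k - j) + j] with [w j <> 0] and put [u = 0]. *)
Lemma symbols_eq0_of_degree0 :
    (forall i, size (G i) <= 1)%N -> (a != 0) || (c != 0) ->
  forall k, G k = 0.
Proof.
move=> sG ac k.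
have [j wj] : exists j, w j != 0.
  have [c0|] := eqVneq c 0; last by exists 0; rewrite /w mulr0z add0r.
  by exists 1; move: ac; rewrite /w c0 eqxx orbF addr0.
apply/polyP => n; rewrite coef0; apply: poly_eq0_mulx => l.
have := @symbol_coef_relation (k - j) j 0 0 n l 0 (sG _) (sG _) isT.
rewrite subrK addr0 mulr0 subr0 mulr0n -mulrA => /eqP.
by rewrite mulf_eq0 (negPf wj) => /eqP.
Qed.

(** The equation for the pair [(i, i)] has a nonzero left-hand side, of degree
    [2 d - 1] where [d] is the degree of [G i]. *)
Lemma symbol_degree_double i : (1 < size (G i))%N ->
  w i != 0 /\ (((size (G i)).-1).*2.-1 < size (G (i + i)))%N.
Proof.
move=> si; set d := (size (G i)).-1.
have sd : (size (G i) <= d.+1)%N by rewrite /d; lia.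
have d0 : (0 < d)%N by rewrite /d; lia.
have An0 : (G i)`_d != 0.
  by rewrite -lead_coefE lead_coef_eq0 -size_poly_gt0; lia.
have [u Au] := exists_nonroot An0.
have [|l] := @exists_nonroot ((G i)`_d * ('X - u%:P)).
  by rewrite mulf_neq0 // polyXsubC_eq0.
rewrite !hornerE mulf_eq0 negb_or => /andP[Al lu].
have Hk : (d + d <= (d.*2.-1).+1)%N by lia.
have := @symbol_coef_relation i i d d d.*2.-1 l u sd sd Hk.
have -> : (d.*2.-1.+1 == d + d)%N by lia.
rewrite mulr1n -mulrnBl -mulrBr => E.
have : w i * (l - u) * ((G (i + i))`_d.*2.-1).[l + u] != 0.
  by rewrite E mulf_neq0 ?mulf_neq0 // mulrn_eq0 negb_or lu -lt0n d0.
rewrite !mulf_eq0 !negb_or => /andP[/andP[-> _] q0]; split=> //.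
by rewrite ltnNge; apply: contra q0 => q0; rewrite nth_default ?horner0.
Qed.

(** If [G 0] had degree at most [0], the pair [(0, i)] would have a left-hand side
    of degree less than that of [G i], so that [w i] would be zero.  Degree [d]
    at least [2] is excluded by [2 d - 1 <= d], the pair [(0, 0)]. *)
Lemma symbol0_degree1 i : (1 < size (G i))%N -> size (G 0) = 2%N.
Proof.
move=> si; have [wi _] := symbol_degree_double si.
have s0 : (1 < size (G 0))%N.
  rewrite ltnNge; apply/negP => s0; set d := (size (G i)).-1.
  have sd : (size (G i) <= d.+1)%N by rewrite /d; lia.
  have : (G i)`_d == 0; last first.
    by rewrite -lead_coefE lead_coef_eq0 -size_poly_eq0; lia.
  apply/eqP/poly_eq0_mulx => l.
  have := @symbol_coef_relation 0 i 0 d d l 0 s0 sd (leqnSn _).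
  rewrite !add0r addr0 mulr0 subr0.
  have -> : (d.+1 == 0 + d)%N = false by lia.
  by move=> /eqP; rewrite mulr0n -mulrA mulf_eq0 (negPf wi) => /eqP.
by have [_] := symbol_degree_double s0; rewrite addr0; lia.
Qed.

Section Degree1.
Hypothesis sG0 : size (G 0) = 2%N.

Let w0 : w 0 = c. Proof. by rewrite /w mulr0z add0r. Qed.

Let cn0 : c != 0.
Proof. by rewrite -w0; case: (@symbol_degree_double 0); rewrite ?sG0. Qed.

(** The pair [(0, 0)] says that [c A(l + u) = A(l) A(u)] when [l <> u].  Here
    [u = 0] gives [A(0) = c], and then [u = - l] exhibits [A] as a divisor of the
    nonzero constant [c^2]. *)
Lemma symbol0_lead : (G 0)`_1 = c%:P.
Proof.
set A := (G 0)`_1.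
have E l u : c * (l - u) * A.[l + u] = (l - u) * (A.[l] * A.[u]).
  have := @symbol_coef_relation 0 0 1 1 1 l u.
  rewrite sG0 w0 addr0 => /(_ isT isT isT).
  by rewrite -mulrBr.
have An0 : A != 0.
  have := lead_coef_eq0 (G 0).
  by rewrite lead_coefE sG0 /= -size_poly_eq0 sG0 => ->.
have A0 : A.[0] = c.
  have : A * (A.[0] - c)%:P = 0.
    apply: poly_eq0_mulx => l; have := E l 0; rewrite subr0 addr0 => El.
    rewrite hornerM hornerC.
    transitivity (l * (A.[l] * A.[0]) - c * l * A.[l]); first by ring.
    by rewrite El subrr.
  by move=> /eqP; rewrite mulf_eq0 (negPf An0) polyC_eq0 subr_eq0 => /eqP.
have unit_prod : A * (A \Po (- 'X)) = (c ^+ 2)%:P.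
  apply/eqP; rewrite -subr_eq0; apply/eqP/poly_eq0_mulx => l.
  have := E l (- l); rewrite subrr A0 opprK -mulr2n => El.
  rewrite !hornerE horner_comp !hornerE.
  apply: (@mulfI _ 2%:R); first by rewrite pnatr_eq0.
  transitivity (l *+ 2 * (A.[l] * A.[- l]) - c * l *+ 2 * c); first by ring.
  by rewrite -El mulrnAr subrr mulr0.
have : A \is a GRing.unit.
  have : (c ^+ 2)%:P \is a @GRing.unit {poly K}.
    by rewrite poly_unitE size_polyC coefC /= unitfE expf_neq0.
  by rewrite -unit_prod unitrM => /andP[].
rewrite poly_unitE => /andP[/eqP sA _].
by rewrite (size1_polyC (p := A)) ?sA // -horner_coef0 A0.
Qed.

(** Put [u = - l] in the pair [(k, 0)]: with [d] the degree and [A] the leading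
    coefficient of [G k], [(c + w k) A(0) = c (1 + d) A(l)] for [l <> 0].  So [A] is
    constant, and cancelling it leaves [w k = c d]. *)
Lemma symbol_lead_const k : G k != 0 ->
  w k = c *+ (size (G k)).-1 /\ exists2 r, r != 0 & lead_coef (G k) = r%:P.
Proof.
move=> Gk; set d := (size (G k)).-1; set A := lead_coef (G k).
have An0 : A != 0 by rewrite lead_coef_eq0.
have sd : (size (G k) <= d.+1)%N by rewrite /d; lia.
have E l : (c + w k) * l * A.[0] = (c *+ d.+1) * l * A.[l].
  have := @symbol_coef_relation k 0 d 1 d l (- l) sd.
  rewrite sG0 addr0 addn1 eqxx => /(_ isT (leqnn _)).
  rewrite symbol0_lead w0 hornerC subrr -/A mulr1n.
  move=> Er; transitivity ((c * l - w k * - l) * A.[0]); first by ring.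
  by rewrite Er mulrS; ring.
have cd0 : c *+ d.+1 != 0 by rewrite mulrn_eq0.
pose r := (c + w k) * A.[0] / (c *+ d.+1).
have Ar : A = r%:P.
  apply/eqP; rewrite -subr_eq0; apply/eqP/poly_eq0_mulx => l.
  apply: (mulfI cd0); rewrite mulr0 hornerD hornerN hornerC.
  transitivity (c *+ d.+1 * l * A.[l] - l * (r * (c *+ d.+1))); first by ring.
  by rewrite -E /r divfK //; ring.
have rn0 : r != 0 by rewrite -(polyC_eq0 r) -Ar.
split; last by exists r.
have := E 1; rewrite Ar !hornerC !mulr1 => /(mulIf rn0).
by rewrite mulrS => /addrI.
Qed.

(** If [G k = 0], the pair [(k, - k)] gives [w k = w (- k) = 0], because
    [G 0 <> 0]; but [w k + w (- k) = 2 c]. *)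
Lemma symbol_neq0 k : G k != 0.
Proof.
apply/eqP => Gk0.
have E l : w (- k) * l - w k * (1 - l) = 0.
  have := G_rel k (- k) l (1 - l).
  rewrite Gk0 subrr /evalY !rmorph0 ?comp_poly0.
  rewrite mul0r mulr0 subrr => /(congr1 (fun p : {poly K} => p`_1)).
  rewrite coef0 coefZ coef_map symbol0_lead /= /horner_eval hornerC.
  move=> /esym/eqP.
  by rewrite mulf_eq0 (negPf cn0) orbF => /eqP.
have e1 : w (- k) = 0 by have := E 1; rewrite subrr mulr1 mulr0 subr0.
have e2 : w k = 0.
  by have /eqP := E 0; rewrite subr0 mulr0 mulr1 sub0r oppr_eq0 => /eqP.
have : w (- k) + w k = 0 by rewrite e1 e2 addr0.
rewrite /w mulrNz; set x := a *~ k.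
have -> : - x + c + (x + c) = c *+ 2 by ring.
by move=> /eqP; rewrite mulrn_eq0 (negPf cn0).
Qed.

(** The degree [d k] is an affine function of [k] with value [1] at [0], and it is
    a natural number at [k = -2, -1, 1, 2]: so its slope [a / c] is zero. *)
Lemma symbol_a_eq0 : a = 0.
Proof.
pose d (k : int) := (size (G k)).-1.
have wd k : a *~ k + c = c *+ d k.
  by have [] := symbol_lead_const (symbol_neq0 k).
have inj m n : c *+ m = c *+ n -> m = n.
  move=> /eqP; rewrite -[c *+ m]mulr_natr -[c *+ n]mulr_natr.
  by rewrite (inj_eq (mulfI cn0)) eqr_nat => /eqP.
have d1 := wd 1; have dN1 := wd (-1); have d2 := wd 2; have dN2 := wd (- 2).
have e1 : (d 1%R + d (-1)%R = 2)%N.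
  by apply: inj; rewrite mulrnDr -d1 -dN1 mulrNz; ring.
have e2 : (d 2%R + 1 = d 1%R + d 1%R)%N.
  by apply: inj; rewrite !mulrnDr -d1 -d2; ring.
have e3 : (d (-2)%R + 1 = d (-1)%R + d (-1)%R)%N.
  by apply: inj; rewrite !mulrnDr -dN1 -dN2 !mulrNz; ring.
have e4 : (d 1%R = 1)%N by lia.
by move: d1; rewrite e4 mulr1n -[RHS]add0r => /addIr.
Qed.

Lemma symbol_degree1 k : size (G k) = 2%N.
Proof.
have [] := symbol_lead_const (symbol_neq0 k).
rewrite /w symbol_a_eq0 mul0rz add0r.
move=> /eqP; rewrite -[X in X == _]mulr1 -mulr_natr (inj_eq (mulfI cn0)).
rewrite (eqr_nat K 1) => /eqP.
by have := symbol_neq0 k; rewrite -size_poly_gt0; lia.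
Qed.

(** Write [G i = al i X + b i].  The coefficient of [d] makes [al / c] a morphism
    from the integers to the multiplicative group.  The constant coefficient
    of the pair [(i, 0)] at [l = 0] gives [c b_i = al_i b_0], and that of [(0, 0)]
    is the functional equation of [size_le2_of_functional]. *)
Lemma symbol_solution : exists rho sigma tau : K, tau != 0 /\
  forall i, G i = (tau ^ i)%:P%:P * (c%:P%:P * 'X + (rho *: 'X + sigma%:P)%:P).
Proof.
pose al i := ((G i)`_1)`_0; pose b i := (G i)`_0.
have alP i : (G i)`_1 = (al i)%:P /\ al i != 0.
  have [_ [r rn0]] := symbol_lead_const (symbol_neq0 i).
  by rewrite lead_coefE symbol_degree1 /= /al => ->; rewrite coefC.
have GE i : G i = (al i)%:P *: 'X + (b i)%:P.
  apply/polyP => -[|[|n]]; rewrite coefD coefZ coefX coefC /=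
    ?mulr0 ?add0r ?mulr1 ?addr0 //.
  - by case: (alP i).
  - by rewrite nth_default // symbol_degree1.
have ev i l : evalY l (G i) = al i *: 'X + (b i).[l]%:P.
  rewrite /evalY [in LHS]GE rmorphD /= map_polyC /= map_polyZ /= map_polyX.
  by rewrite /horner_eval hornerC.
have alM i j : al i * al j = c * al (i + j).
  have := @symbol_coef_relation i j 1 1 1 1 0.
  rewrite !symbol_degree1 => /(_ isT isT isT).
  rewrite (proj1 (alP i)) (proj1 (alP j)) (proj1 (alP (i + j))) !hornerC.
  rewrite /w symbol_a_eq0 !mul0rz !add0r !mulr0 !subr0 !mulr1 !mulr1n mul1r.
  by move=> <-.
have al0 : al 0 = c by rewrite /al symbol0_lead coefC.
have bE i j l u :
    al j * l * (b i).[l] - al i * u * (b j).[u]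
    = c * (l - u) * (b (i + j)).[l + u].
  have := congr1 (horner^~ 0) (G_rel i j l u).
  rewrite !ev /w symbol_a_eq0 !mul0rz !add0r !hornerE !horner_comp !hornerE.
  by move=> E; rewrite mulrBr -E; ring.
pose t i := al i / c.
have tD i j : t (i + j) = t i * t j.
  by rewrite /t mulf_div alM -mulf_div divff // mul1r.
have tE : forall i, t i = t 1 ^ i.
  by apply: int_exp_morph => //; rewrite /t al0 divff.
have bt i : b i = t i *: b 0.
  apply/eqP; rewrite -subr_eq0; apply/eqP/poly_eq0_mulx => u.
  apply: (mulfI cn0); rewrite mulr0 hornerD hornerN hornerZ.
  have := bE i 0 0 u; rewrite addr0 !add0r mulr0 mul0r add0r => E.
  transitivity (- (c * - u * (b i).[u]) - t i * c * u * (b 0).[u]).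
    by ring.
  by rewrite -E /t divfK //; ring.
have sb0 : (size (b 0) <= 2)%N.
  apply: size_le2_of_functional => l u; apply: (mulfI cn0).
  by have := bE 0 0 l u; rewrite addr0 al0 => E; rewrite [RHS]mulrA -E; ring.
pose rho := (b 0)`_1; pose sigma := (b 0)`_0.
have b0E : b 0 = rho *: 'X + sigma%:P.
  apply/polyP => -[|[|n]]; rewrite coefD coefZ coefX coefC /=
    ?mulr0 ?add0r ?mulr1 ?addr0 //.
  by rewrite nth_default // (leq_trans sb0).
exists rho, sigma, (t 1); split.
  by rewrite /t mulf_neq0 ?invr_eq0 //; case: (alP 1).
move=> i; rewrite GE bt -tE b0E.
have -> : al i = t i * c by rewrite /t divfK.
by rewrite -!mul_polyC !polyCM; ring.
Qed.

End Degree1.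
End SymbolRelation.
End PolynomialTools.

(** * Free modules of rank one *)

Section FreeRankOne.
Variables (K : fieldType) (V : lmodType {poly K}) (v : V).
Hypothesis v_free : free_on v.

Lemma free_on_gen (u : V) : exists q : {poly K}, u = q *: v.
Proof.
have [q [-> _]] := v_free u.
by exists (\sum_(i <- msupp q) q@_i); rewrite scaler_suml.
Qed.

Lemma free_on_eq0 (q : {poly K}) : q *: v = 0 -> q = 0.
Proof.
move=> qv; have [q0 [_ uniq_q0]] := v_free 0.
have z : q0 = 0 by apply: uniq_q0; rewrite msupp0 big_nil.
have : q0 = << q *g tt >>.
  apply: uniq_q0; rewrite msuppU; case: eqP => _; first by rewrite big_nil.
  by rewrite big_seq_fset1 mcoeffUU.
by rewrite z => /(congr1 (mcoeff tt)); rewrite mcoeff0 mcoeffUU.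
Qed.

Lemma free_on_inj (p q : {poly K}) : p *: v = q *: v -> p = q.
Proof.
move=> /eqP; rewrite -subr_eq0 -scalerBl => /eqP /free_on_eq0 /eqP.
by rewrite subr_eq0 => /eqP.
Qed.

Lemma mcoeff_lact (f : {poly {poly K}}) k : (lact f v)@_k = f`_k *: v.
Proof.
rewrite /lact raddf_sum /=; under eq_bigr => n _ do rewrite mcoeffU.
have [lek|gtk] := leqP (size f) k.
  rewrite nth_default // scale0r big1 // => n _.
  by case: eqP => // nk; move: (ltn_ord n); rewrite nk ltnNge lek.
rewrite (bigD1 (Ordinal gtk)) //= eqxx big1 ?addr0 // => n.
by rewrite -val_eqE /= => /negPf ->.
Qed.

Lemma lact_surj (p : lpoly V) : exists f, p = lact f v.
Proof.
have [phi phiE] := choice free_on_gen.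
exists (\sum_(n <- msupp p) phi p@_n *: 'X^n).
apply/malgP => k.
rewrite mcoeff_lact [in LHS](monalgE p) raddf_sum coef_sum scaler_suml.
apply: eq_bigr => n _ /=; rewrite mcoeffU coefZ coefXn eq_sym.
by case: eqP => _; rewrite ?mulr1 ?mulr0 ?scale0r.
Qed.

End FreeRankOne.

(** * The classification *)

Section RankOne.
Variables (K : numFieldType) (a c : K) (A : lieConfAlg K) (L : int -> A).
Hypothesis hCW : is_CW a c L.
Variables (M : confModule A) (v : M).
Hypothesis v_free : free_on v.
Variable G : int -> {poly {poly K}}.
Hypothesis GE : forall i, laction (L i) v = lact (swapXY (G i)) v.

Lemma eact_gen l i : eact (@laction _ _ M) l (L i) v = evalY l (G i) *: v.
Proof. by rewrite /eact GE lev_lact horner_swapXY. Qed.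

(** Both sides are the coefficients of the generator in the evaluated module
    axiom; on the right the [d] of the bracket becomes [- (l + u)], which turns
    [w_i d + (a (i + j) + 2 c) l] into [w_j l - w_i u]. *)
Lemma symbol_relation i j l u :
    (evalY u (G j) \Po ('X + l%:P)) * evalY l (G i)
    - (evalY l (G i) \Po ('X + u%:P)) * evalY u (G j)
  = ((a *~ j + c) * l - (a *~ i + c) * u) *: evalY (l + u) (G (i + j)).
Proof.
have actP := laction_sesqui M.
apply: (free_on_inj v_free).
have := eact_bracket actP (@laction_bracket _ _ M) (L i) (L j) v l u.
rewrite !eact_gen !(eactZr actP) !eact_gen !scalerA -scalerBl => ->.
case: hCW => _ ->; rewrite lev_lact (eactZl actP) eact_gen scalerA mul_polyC.
congr (_ *: _ *: v); rewrite /scal /dvar /lvar.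
by rewrite !(hornerD, hornerM, hornerC, hornerX) mulrzDr; ring.
Qed.

Lemma trivial_of_symbol0 :
  (forall i, G i = 0) -> forall x m, laction (c := M) x m = 0.
Proof.
move=> G0 x m; have actP := laction_sesqui M.
have eact0 l : eact (@laction _ _ M) l x m = 0.
  have [q ->] := free_on_gen v_free m; rewrite (eactZr actP).
  case: hCW => /(_ x) [r [-> _]] _.
  rewrite (big_morph _ (eactDl actP l v) (eact0l actP l v)).
  rewrite big1 ?scaler0 // => i _.
  by rewrite (eactZl actP) eact_gen G0 /evalY rmorph0 scale0r scaler0.
have [f fE] := lact_surj v_free (laction x m).
suff f0 : f = 0 by rewrite fE f0 /lact size_poly0 big_ord0.
apply: poly_eq0_nat => [|n].
  by move=> p; rewrite -[RHS](pchar_num K p) !inE -polyC_natr polyC_eq0.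
apply: (free_on_eq0 v_free); rewrite -polyC_natr -lev_lact -fE; exact: eact0.
Qed.

End RankOne.

Theorem rank_one_CW_modules (K : numFieldType) (a c : K)
  (A : lieConfAlg K) (L : int -> A) (hCW : is_CW a c L)
  (M : confModule A) (v : M) (hv : free_on v) (hM : nontrivial_module M) :
  a = 0 /\
  (c = 0 -> exists h : int -> {poly K},
     forall i : int, laction (L i) v = lact (map_poly polyC (h i)) v) /\
  (c <> 0 -> exists rho sigma tau : K, tau <> 0 /\
     forall i : int, laction (L i) v =
       lact (scal (tau ^ i) *
             (scal c * dvar K + scal rho * lvar K + scal sigma)) v).
Proof.
have [f fE] := choice (fun i => lact_surj hv (laction (L i) v)).
pose G i := swapXY (f i).
have GE i : laction (L i) v = lact (swapXY (G i)) v by rewrite swapXYK.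
have G_rel := symbol_relation hCW hv GE.
have [[i si]|deg0] := pselect (exists i, (1 < size (G i))%N).
  have sG0 := symbol0_degree1 G_rel si.
  have cn0 : c <> 0.
    have [+ _] := symbol_degree_double G_rel (i := 0) ltac:(by rewrite sG0).
    by rewrite mulr0z add0r => /eqP.
  split; first exact: (symbol_a_eq0 G_rel sG0).
  split=> // _.
  have [rho [sigma [tau [tau0 solE]]]] := symbol_solution G_rel sG0.
  exists rho, sigma, tau; split; first exact/eqP.
  move=> k; rewrite GE solE; congr (lact _ v).
  rewrite rmorphM rmorphD rmorphM /= !swapXY_polyC !map_polyC /= swapXY_X.
  by rewrite rmorphD /= map_polyC map_polyZ /= map_polyX -mul_polyC addrA.
have sG k : (size (G k) <= 1)%N.
  by rewrite leqNgt; apply/negP => ?; apply: deg0; exists k.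
have ac0 : ~~ ((a != 0) || (c != 0)).
  apply/negP => ac; apply: hM => x m; apply: (trivial_of_symbol0 hCW hv GE).
  exact: (symbols_eq0_of_degree0 G_rel sG ac).
move: ac0; rewrite negb_or !negbK => /andP[/eqP a0 /eqP c0].
split=> //; split=> // _; exists (fun i => (G i)`_0) => i.
by rewrite GE [in LHS](size1_polyC (sG i)) swapXY_polyC.
Qed.

Theorem theorem4p1 (R : realType) (a c : R[i])
  (A : lieConfAlg R[i]) (L : int -> A) (hCW : is_CW a c L)
  (M : confModule A) (v : M) (hv : free_on v) (hM : nontrivial_module M) :
  a = 0 /\
  (c = 0 -> exists h : int -> {poly R[i]},
     forall i : int, laction (L i) v = lact (map_poly polyC (h i)) v) /\
  (c <> 0 -> exists rho sigma tau : R[i], tau <> 0 /\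
     forall i : int, laction (L i) v =
       lact (scal (tau ^ i) *
             (scal c * dvar R[i] + scal rho * lvar R[i] + scal sigma)) v).
Proof. exact: rank_one_CW_modules hCW M v hv hM. Qed.
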